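(* Let $m,n,a$ be positive integers with $m\ge 5$. The number of standard Young tableaux of battery shape $[(m^n),a,5]$ is equal to $f^{(m^n)}\cdot{}_{[3,5,7,9]}F_{[2,4,6,8]}$ evaluated with all arguments $z_i=1$ and with the following parameters, where $t,v,w$ denote the first three summation indices: upper parameters: row 0: $a,\ m,\ -n$; row 1: $a+t,\ m-1,\ -n-1,\ -t,\ -t$; row 2: $a+t+v,\ m-2,\ -n-2,\ -t-1,\ -t-1,\ -v,\ -v$; row 3: $a+t+v+w,\ m-3,\ -n-3,\ -t-2,\ -t-2,\ -v-1,\ -v-1,\ -w,\ -w$; lower parameters: row 0: $-mn,\ 1$; row 1: $-mn+t,\ -t-1,\ -t-1,\ 1$; row 2: $-mn+t+v,\ -t-2,\ -t-2,\ -v-1,\ -v-1,\ 1$; row 3: $-mn+t+v+w,\ -t-3,\ -t-3,\ -v-2,\ -v-2,\ -w-1,\ -w-1,\ 1$. That is, it is equal to $$f^{(m^n)}\sum_{t=0}^{n}\sum_{v=0}^{t}\sum_{w=0}^{v}\sum_{r=0}^{w} A_t\,B_{t,v}\,C_{t,v,w}\,D_{t,v,w,r},$$ where $$A_t=\frac{(a)_t(m)_t(-n)_t}{(-mn)_t(1)_t\,t!},\qquad B_{t,v}=\frac{(a+t)_v(m-1)_v(-n-1)_v(-t)_v^2}{(-mn+t)_v(-t-1)_v^2(1)_v\,v!},$$ $$C_{t,v,w}=\frac{(a+t+v)_w(m-2)_w(-n-2)_w(-t-1)_w^2(-v)_w^2}{(-mn+t+v)_w(-t-2)_w^2(-v-1)_w^2(1)_w\,w!},$$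 $$D_{t,v,w,r}=\frac{(a+t+v+w)_r(m-3)_r(-n-3)_r(-t-2)_r^2(-v-1)_r^2(-w)_r^2}{(-mn+t+v+w)_r(-t-3)_r^2(-v-2)_r^2(-w-1)_r^2(1)_r\,r!}.$$ Here $f^{(m^n)}$ is the number of standard Young tableaux of rectangular shape $(m^n)$.
   Context: $(m^n)$ denotes the partition with $n$ parts all equal to $m$ (Young diagram with $n$ rows and $m$ columns; row 1 is the top row). For integers $a\ge 1$, $1\le k\le m$, the battery shape $[(m^n),a,k]$ (of size $mn+a$) is obtained from the Young diagram of $(m^n)$ by adding a column of $a$ cells directly above the top cell of the $k$-th column; in coordinates it consists of the cells $(i,j)$ with $1\le i\le n$, $1\le j\le m$, together with the cells $(0,k),(-1,k),\dots,(1-a,k)$, where the first coordinate is the row (increasing downwards) and the second the column. A standard Young tableau of a shape with $M$ cells is a bijection from the set of cells to $\{1,\dots,M\}$ such that entries increase from left to right in each row and from top to bottom in each column (including the added cells). Pochhammer symbol: $(x)_0=1$, $(x)_s=x(x+1)\cdots(x+s-1)$ for $s\ge1$. Multiple hypergeometric function: for rows $i=0,\dots,N$ with upper parameters $a_{i,1},\dots,a_{i,x_i}$, lower parameters $b_{i,1},\dots,b_{i,y_i}$ and arguments $z_i$, where $a_{i,j},b_{i,j}$ may depend on the summation indices $m_l$ with $l<i$, $${}_{[x_0,\dots,x_N]}F_{[y_0,\dots,y_N]}[\cdots]=\sum_{m_0\ge 0}\ \sum_{m_1=0}^{m_0}\cdots\sum_{m_N=0}^{m_{N-1}}\ \prod_{i=0}^{N}\frac{\prod_{j=1}^{x_i}(a_{i,j})_{m_i}}{\prod_{j=1}^{y_i}(b_{i,j})_{m_i}}\frac{z_i^{m_i}}{m_i!}.$$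 When row $0$ contains an upper parameter $-p$ and a lower parameter $-q$ with integers $0\le p\le q$, the sum over $m_0$ is truncated to $0\le m_0\le p$. In the claim the indices $m_0,m_1,m_2,m_3$ are called $t,v,w,r$. *)

(* Defs.v *)
From mathcomp Require Export all_boot all_order all_algebra.
From mathcomp Require Export finmap.

Set Implicit Arguments.
Unset Strict Implicit.
Unset Printing Implicit Defensive.

Import Order.TTheory GRing.Theory Num.Theory.
Local Open Scope fset_scope.
Local Open Scope ring_scope.

(* A cell is (row, column); rows increase downwards and may be <= 0. *)
Definition cell : Type := (int * int)%type.

(* (m^n): n rows of length m. *)
Definition rect_shape (m n : nat) : {fset int * int} :=
  [fset ((i%:Z, j%:Z) : cell) | i in iota 1 n, j in iota 1 m].

(* The a cells (0,k), (-1,k), ..., (1-a,k). *)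
Definition column_shape (a k : nat) : {fset int * int} :=
  [fset ((1 - b%:Z, k%:Z) : cell) | b in iota 1 a].

(* [(m^n),a,k]; meant for 0 < a and 0 < k <= m. *)
Definition battery_shape (m n a k : nat) : {fset int * int} :=
  rect_shape m n `|` column_shape a k.

(* Entries are shifted by one: T c in {0, ..., M-1} stands for the entry
   T c + 1 in {1, ..., M}, where M is the number of cells. *)
Definition standard (D : {fset int * int}) (T : {ffun D -> 'I_#|` D|}) : bool :=
  [&& injectiveb T,
      [forall e, exists c, T c == e],
      [forall c : D, forall d : D,
        ((val c).1 == (val d).1) && ((val c).2 < (val d).2) ==> (T c < T d)%N] &
      [forall c : D, forall d : D,
        ((val c).2 == (val d).2) && ((val c).1 < (val d).1) ==> (T c < T d)%N]].

Definition num_syt (D : {fset int * int}) : nat :=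
  #|[set T : {ffun D -> 'I_#|` D|} | standard T]|.

(* Rising factorial (x)_s. *)
Definition poch (F : fieldType) (x : F) (s : nat) : F :=
  \prod_(i < s) (x + i%:R).

(* HypRow u l z next is a row with upper parameters u, lower parameters l and
   argument z; next receives the summation index of this row, so the parameters
   of each row may depend on the indices of all earlier rows. *)
Inductive hyp_rows (F : Type) : Type :=
| HypEnd
| HypRow of seq F & seq F & F & (nat -> hyp_rows F).
Arguments HypEnd {F}.

Definition hyp_term (F : fieldType) (u l : seq F) (z : F) (s : nat) : F :=
  (\prod_(x <- u) poch x s) / (\prod_(y <- l) poch y s) * (z ^+ s / s`!%:R).

(* Terminating multiple hypergeometric series: the first index runs over
   0, ..., p and each later one is bounded by its predecessor. A first row with
   an upper parameter -p and a lower parameter -q, 0 <= p <= q, truncates the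
   series at p by convention; here p has to be supplied explicitly. *)
Fixpoint multi_hyp (F : fieldType) (p : nat) (R : hyp_rows F) : F :=
  match R with
  | HypEnd => 1
  | HypRow u l z next =>
      \sum_(0 <= s < p.+1) hyp_term u l z s * multi_hyp s (next s)
  end.

(* The series of type [3,5,7,9] / [2,4,6,8], all arguments being 1. *)
Definition battery5_rows (m n a : nat) : hyp_rows rat :=
  let M : rat := m%:R in let N : rat := n%:R in let A : rat := a%:R in
  HypRow [:: A; M; - N]
         [:: - (M * N); 1] 1
  (fun t' => let t : rat := t'%:R in
  HypRow [:: A + t; M - 1; - N - 1; - t; - t]
         [:: - (M * N) + t; - t - 1; - t - 1; 1] 1
  (fun v' => let v : rat := v'%:R in
  HypRow [:: A + t + v; M - 2; - N - 2; - t - 1; - t - 1; - v; - v]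
         [:: - (M * N) + t + v; - t - 2; - t - 2; - v - 1; - v - 1; 1] 1
  (fun w' => let w : rat := w'%:R in
  HypRow [:: A + t + v + w; M - 3; - N - 3; - t - 2; - t - 2;
             - v - 1; - v - 1; - w; - w]
         [:: - (M * N) + t + v + w; - t - 3; - t - 3; - v - 2; - v - 2;
             - w - 1; - w - 1; 1] 1
  (fun=> HypEnd)))).

(* The expanded form: the summand is A_t B_{t,v} C_{t,v,w} D_{t,v,w,r}. *)
Definition factorA (m n a t : nat) : rat :=
  let M : rat := m%:R in let N : rat := n%:R in
  (poch a%:R t * poch M t * poch (- N) t)
  / (poch (- (M * N)) t * poch 1 t * t`!%:R).

Definition factorB (m n a t v : nat) : rat :=
  let M : rat := m%:R in let N : rat := n%:R in
  let t' : rat := t%:R in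
  (poch (a%:R + t') v * poch (M - 1) v * poch (- N - 1) v
     * poch (- t') v ^+ 2)
  / (poch (- (M * N) + t') v * poch (- t' - 1) v ^+ 2 * poch 1 v * v`!%:R).

Definition factorC (m n a t v w : nat) : rat :=
  let M : rat := m%:R in let N : rat := n%:R in
  let t' : rat := t%:R in let v' : rat := v%:R in
  (poch (a%:R + t' + v') w * poch (M - 2) w * poch (- N - 2) w
     * poch (- t' - 1) w ^+ 2 * poch (- v') w ^+ 2)
  / (poch (- (M * N) + t' + v') w * poch (- t' - 2) w ^+ 2
     * poch (- v' - 1) w ^+ 2 * poch 1 w * w`!%:R).

Definition factorD (m n a t v w r : nat) : rat :=
  let M : rat := m%:R in let N : rat := n%:R in
  let t' : rat := t%:R in let v' : rat := v%:R in let w' : rat := w%:R in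
  (poch (a%:R + t' + v' + w') r * poch (M - 3) r * poch (- N - 3) r
     * poch (- t' - 2) r ^+ 2 * poch (- v' - 1) r ^+ 2 * poch (- w') r ^+ 2)
  / (poch (- (M * N) + t' + v' + w') r * poch (- t' - 3) r ^+ 2
     * poch (- v' - 2) r ^+ 2 * poch (- w' - 1) r ^+ 2 * poch 1 r * r`!%:R).

(* Main.v *)
Require Import Defs.
From mathcomp Require Import perm zify ring.
Import GRing.Theory Num.Theory.
Set Implicit Arguments.
Unset Strict Implicit.
Unset Printing Implicit Defensive.
Local Open Scope ring_scope.

(** Let the last cell of the added column carry the entry e. The rectangle
    cells with entries smaller than e form a Young diagram h, and every column
    of h lies to the left of the column below the added cells, since the latter
    only contains entries larger than e. Cutting at e therefore writes the
    number of fillings as a sum over the diagrams h with at most p columns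
    (p = 4 for the battery over the fifth column): the number of ways to fill h
    together with the first a - 1 added cells, times the number of ways to fill
    the complement of h in the rectangle.

    Both factors have product formulas. A diagram whose column lengths are
    q_0 <= ... <= q_(k-1) has |q|! * Delta(x) / (x_0! ... x_(k-1)!) standard
    fillings, where x_i = q_i + i and Delta is the Vandermonde product
    (Frobenius). By removal of the cell with the largest entry this amounts to
    the identity [vandermonde_shift], which is immediate from the Leibniz
    expansion once Delta is written as a determinant of falling factorials.
    The part below the cut is h plus an independent chain, which multiplies the
    formula by a binomial coefficient ([num_fillings_low]). The part above the
    cut, turned upside down, is the diagram of the column lengths n - h_j.

    When h has only p columns, the second Vandermonde product differs from its
    value at h = 0 only in factors involving the first p columns, and these
    factors reproduce the product formula of h itself: this is
    [num_completions_low], and it accounts for the squares in the series. What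
    is left is a product over the p columns of quotients of factorials, that
    is, of the rising factorials (m - j)_s and (-n - j)_s ([poch_column]).

    The cutting is not done by an explicit bijection on fillings. The number of
    fillings of an order ideal satisfies a recursion over its maximal cells, the
    number of completions satisfies the opposite recursion, and summing their
    product over all diagrams telescopes ([path_sum]).

    Columns are numbered from 0 in the proof, so that p is at the same time the
    number of columns to the left of the added one and its index. *)

(** * Counting linear extensions by their last element *)

Section LinearExtensions.
Local Open Scope nat_scope.
Variables (A : finType) (r : rel A) (N : nat).
Implicit Types (S : {set A}) (f g : {ffun A -> 'I_N.+1}).

(** Values off S are pinned to 0, so that the linear extensions of all subsets
    of A live in one type and cells can be removed without changing it. A
    common bound N for all of them serves the same purpose. *)
Definition linext S : {set {ffun A -> 'I_N.+1}} :=
  [set f : {ffun A -> 'I_N.+1} | [&& [forall x in S, forall y in S, (f x == f y) ==> (x == y)],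
               [forall x in S, f x < #|S|],
               [forall x in ~: S, f x == ord0] &
               [forall x in S, forall y in S, r x y ==> (f x < f y)]]].

Lemma linextP S f :
  reflect [/\ {in S &, injective f}, {in S, forall x, f x < #|S|},
              {in ~: S, forall x, f x = ord0} &
              {in S &, forall x y, r x y -> f x < f y}]
          (f \in linext S).
Proof.
rewrite inE; apply: (iffP and4P) => -[inj lt out mon]; split.
- move=> x y xS yS /eqP.
  by move/forall_inP/(_ x xS)/forall_inP/(_ y yS)/implyP: inj => i /i /eqP.
- exact/forall_inP.
- by move=> x xS; apply/eqP; move/forall_inP: out; apply.
- move=> x y xS yS; apply/implyP.
  by move/forall_inP/(_ x xS)/forall_inP/(_ y yS): mon.
- apply/forall_inP => x xS; apply/forall_inP => y yS; apply/implyP => /eqP e.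
  by apply/eqP; apply: inj.
- exact/forall_inP.
- by apply/forall_inP => x /out ->.
- apply/forall_inP => x xS; apply/forall_inP => y yS; apply/implyP.
  exact: mon.
Qed.

Lemma card_linext0 : #|linext set0| = 1.
Proof.
rewrite -(cards1 [ffun _ : A => ord0 : 'I_N.+1]); congr #|pred_of_set _|.
apply/setP => f; rewrite in_set1; apply/linextP/eqP => [[_ _ out _]|->].
  by apply/ffunP => x; rewrite ffunE out // !inE.
by split=> x; rewrite ?inE // ffunE.
Qed.

(** An injection of S into the numbers below #|S| is onto, so its largest
    possible value is attained. *)
Lemma linext_top S f : f \in linext S -> S != set0 ->
  exists2 x, x \in S & f x = #|S|.-1 :> nat.
Proof.
move=> /linextP[inj lt _ _] S0.
have uq : uniq [seq val (f x) | x <- enum S].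
  rewrite map_inj_in_uniq ?enum_uniq // => x y; rewrite !mem_enum => xS yS.
  by move/val_inj; apply: inj.
have sub : {subset [seq val (f x) | x <- enum S] <= iota 0 #|S|}.
  move=> k /mapP[x]; rewrite mem_enum => xS ->.
  by rewrite mem_iota /= add0n lt.
have [|_] := uniq_min_size uq sub; first by rewrite size_iota size_map cardE.
move=> /(_ #|S|.-1); rewrite mem_iota /= add0n prednK ?card_gt0 // leqnn.
by move/mapP => [x]; rewrite mem_enum => xS ->; exists x.
Qed.

(** Erasing the largest entry, or putting it back, are inverse bijections;
    maximality of x is what makes the second one order preserving. *)
Lemma card_linext_at S x : #|S| <= N.+1 -> x \in S ->
  [forall y in S, ~~ r x y] ->
  #|[set f in linext S | f x == #|S|.-1 :> nat]| = #|linext (S :\ x)|.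
Proof.
move=> SN xS /forall_inP xmax.
have sE : #|S :\ x| = #|S|.-1 by rewrite (cardsD1 x S) xS.
have S_gt0 : 0 < #|S| by rewrite card_gt0; apply/set0Pn; exists x.
pose put (k : 'I_N.+1) f := [ffun y => if y == x then k else f y].
have putx k f : put k f x = k by rewrite ffunE eqxx.
have putN k f y : y != x -> put k f y = f y by rewrite ffunE => /negPf->.
have topE : (inord #|S|.-1 : 'I_N.+1) = #|S|.-1 :> nat by rewrite inordK; lia.
rewrite -[RHS](card_in_imset (f := put (inord #|S|.-1))); last first.
  move=> f g /linextP[_ _ f0 _] /linextP[_ _ g0 _] /ffunP e; apply/ffunP => y.
  have [->|yx] := eqVneq y x; first by rewrite f0 ?g0 // !inE eqxx.
  by have := e y; rewrite !putN.
congr #|pred_of_set _|; apply/setP => f; rewrite in_set.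
apply/andP/imsetP => [[/linextP[inj lt out mon] /eqP fx]|[g gL ->]].
  exists (put ord0 f); last first.
    apply/ffunP => y; have [->|yx] := eqVneq y x; last by rewrite !putN.
    by rewrite putx; apply: val_inj; rewrite /= topE.
  apply/linextP; split.
  - move=> y z /setD1P[yx yS] /setD1P[zx zS]; rewrite !putN //.
    exact: inj.
  - move=> y /setD1P[yx yS]; rewrite putN // sE.
    rewrite ltn_neqAle -{1}fx -ltnS prednK // lt // andbT.
    by apply: contra yx => /eqP/val_inj/(inj _ _ yS xS)/eqP.
  - move=> y; rewrite !inE negb_and negbK.
    have [->|yx] /= := eqVneq y x; first by rewrite putx.
    by move=> yS; rewrite putN // out // inE.
  - move=> y z /setD1P[yx yS] /setD1P[zx zS]; rewrite !putN //.
    exact: mon.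
move/linextP: gL => [inj lt out mon].
have ltx y : y \in S -> y != x -> g y < #|S|.-1.
  by move=> yS yx; rewrite -sE lt // !inE yx.
split; last by rewrite putx topE.
apply/linextP; split.
- move=> y z yS zS; have [->|yx] := eqVneq y x; have [->|zx] := eqVneq z x => //.
  + rewrite putx putN // => /(congr1 val) /=; rewrite topE.
    by move=> e; have := ltx z zS zx; rewrite -e ltnn.
  + rewrite putx putN // => /(congr1 val) /=; rewrite topE.
    by move=> e; have := ltx y yS yx; rewrite e ltnn.
  + by rewrite !putN //; apply: inj; rewrite !inE ?yx ?zx.
- move=> y yS; have [->|yx] := eqVneq y x; first by rewrite putx topE prednK.
  by rewrite putN // (leq_trans (ltx y yS yx)) // leq_pred.
- move=> y; rewrite inE => yS.
  have yx : y != x by apply: contra yS => /eqP->.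
  by rewrite putN // out // !inE negb_and yS orbT.
- move=> y z yS zS ryz; have [yx|yx] := eqVneq y x.
    by have := xmax z zS; rewrite -yx ryz.
  have [->|zx] := eqVneq z x; first by rewrite putx topE putN // ltx.
  by rewrite !putN //; apply: mon; rewrite // !inE ?yx ?zx.
Qed.

Lemma card_linext_rec S : #|S| <= N.+1 -> S != set0 ->
  #|linext S| = \sum_(x in S | [forall y in S, ~~ r x y]) #|linext (S :\ x)|.
Proof.
move=> SN S0.
transitivity (\sum_(f in linext S) \sum_(x in S | f x == #|S|.-1 :> nat) 1).
  rewrite -sum1_card; apply: eq_bigr => f fL.
  have [x xS fx] := linext_top fL S0; rewrite (big_pred1 x) // => y.
  apply/andP/eqP => [[yS /eqP fy]|->]; last by rewrite fx.
  by move/linextP: fL => [inj _ _ _]; apply: inj => //; apply/val_inj; rewrite /= fy.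
rewrite (exchange_big_dep (mem S)) /=; last by move=> f x _ /andP[].
rewrite [RHS]big_mkcondr; apply: eq_bigr => x xS.
rewrite (eq_bigl (fun f => f \in [set f in linext S | f x == #|S|.-1 :> nat]));
  last by move=> f; rewrite !in_set xS.
case: ifPn => [xmax|]; first by rewrite sum1_card card_linext_at.
rewrite negb_forall_in => /exists_inP[y yS]; rewrite negbK => rxy.
rewrite big_pred0 //= => f; rewrite in_set.
apply/negP => /andP[/linextP[_ lt _ mon] /eqP fx].
have := mon x y xS yS rxy; rewrite fx ltnNge -ltnS prednK ?lt //.
by rewrite (leq_ltn_trans _ (lt y yS)).
Qed.

End LinearExtensions.

Definition before (c d : cell) : bool :=
  ((c.1 == d.1) && (c.2 < d.2)) || ((c.2 == d.2) && (c.1 < d.1)).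

(** Replaces the subtype of a finite set of integer cells by any finite type
    that enumerates these cells. *)
Lemma num_syt_linext (A : finType) (r : rel A) (N : nat) (D : {fset int * int})
    (pos : A -> cell) :
    #|A| = N.+1 -> injective pos ->
    (forall c, (c \in D) = (c \in codom pos)) ->
    (forall x y, r x y = before (pos x) (pos y)) ->
  num_syt D = #|linext r N [set: A]|.
Proof.
move=> cardA pos_inj posD rE.
have posP x : pos x \in D by rewrite posD codom_f.
pose psi (x : A) : D := FSetSub (posP x).
have psi_inj : injective psi by move=> x y /(congr1 val) /pos_inj.
have sub (d : D) : val d \in codom pos by rewrite -posD; apply: fsvalP.
pose phi (d : D) : A := iinv (sub d).
have phiK : cancel phi psi by move=> d; apply: val_inj; rewrite /= f_iinv.
have psiK : cancel psi phi by move=> x; apply: psi_inj; rewrite phiK.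
have cardD : #|` D| = N.+1 by rewrite cardfE -cardA (bij_eq_card (Bijective phiK psiK)).
rewrite /num_syt /standard; rewrite cardD.
rewrite -!sum1_card.
rewrite (reindex (fun f : {ffun A -> 'I_N.+1} => [ffun d => f (phi d)])); last first.
  exists (fun f : {ffun D -> 'I_N.+1} => [ffun x => f (psi x)]) => f _;
  by apply/ffunP => x; rewrite !ffunE ?phiK ?psiK.
apply: eq_bigl => f; rewrite in_set; apply/and4P/linextP.
  move=> [/injectiveP inj _ /forallP row /forallP col]; split.
  - move=> x y _ _ e; apply: psi_inj; apply: inj.
    by rewrite !ffunE !psiK.
  - by move=> x _; rewrite cardsT cardA.
  - by move=> x; rewrite !inE.
  - move=> x y _ _; rewrite rE => /orP[]/andP[/eqP e lt].
      have /forallP/(_ (psi y)) := row (psi x).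
      by rewrite !ffunE !psiK /= e eqxx lt.
    have /forallP/(_ (psi y)) := col (psi x).
    by rewrite !ffunE !psiK /= e eqxx lt.
move=> [inj _ _ mon].
have inj' : injective [ffun d => f (phi d)].
  move=> c d; rewrite !ffunE => /inj e.
  by rewrite -[c]phiK -[d]phiK e // inE.
split.
- exact/injectiveP.
- apply/forallP => k.
  have : k \in codom [ffun d => f (phi d)].
    by apply: inj_card_onto; rewrite // card_ord -cardD cardfE.
  by move/codomP => [c ->]; apply/existsP; exists c.
- apply/forallP => c; apply/forallP => d; apply/implyP => cd.
  rewrite !ffunE; apply: mon; rewrite ?inE // rE /before.
  by have := congr1 val (phiK c); have := congr1 val (phiK d) => /= -> ->; rewrite cd.
- apply/forallP => c; apply/forallP => d; apply/implyP => cd.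
  rewrite !ffunE; apply: mon; rewrite ?inE // rE /before.
  by have := congr1 val (phiK c); have := congr1 val (phiK d) => /= -> ->; rewrite cd orbT.
Qed.

(** * The product formula for the number of fillings of a Young diagram *)

Definition vandermonde (R : comNzRingType) k (x : nat -> R) : R :=
  \prod_(i < k) \prod_(j < k | (i < j)%N) (x j - x i).

Definition ring_ffact (R : comNzRingType) (x : R) j : R := \prod_(t < j) (x - t%:R).

(** The falling factorials of degree 0, ..., k - 1 are monic, so passing from
    powers to them multiplies the Vandermonde matrix by a unitriangular one. *)
Lemma vandermonde_det (R : comNzRingType) k (x : nat -> R) :
  vandermonde k x = \det (\matrix_(i < k, j < k) ring_ffact (x i) j).
Proof.
pose P j : {poly R} := \prod_(t < j) ('X - (t%:R)%:P).
have sizeP j : size (P j) = j.+1.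
  by rewrite size_prod_XsubC /index_enum -enumT size_enum_ord.
have monP j : P j \is monic by apply: monic_prod_XsubC.
have PE y j : (P j).[y] = ring_ffact y j.
  by rewrite horner_prod; apply: eq_bigr => t _; rewrite hornerXsubC.
pose U := \matrix_(i < k, l < k) (P i)`_l.
have trigU : is_trig_mx U.
  by apply/is_trig_mxP => i j ij; rewrite mxE nth_default // sizeP.
have detU : \det U = 1.
  rewrite det_trig // big1 // => i _; rewrite mxE.
  by have /monicP := monP i; rewrite lead_coefE sizeP.
pose a := \row_(j < k) x j.
have -> : vandermonde k x = \det (Vandermonde k a).
  by rewrite det_Vandermonde; apply: eq_bigr => i _; apply: eq_bigr => j _; rewrite !mxE.
rewrite -[LHS]mul1r -detU -det_mulmx -det_tr; congr (\det _).
apply/matrixP => i j; rewrite !mxE -PE (@horner_coef_wide _ k); last by rewrite sizeP.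
by apply: eq_bigr => l _; rewrite !mxE.
Qed.

(** Both sides are the falling factorial of degree j + 1. This is what makes
    the basis of falling factorials suited to the shift of one variable. *)
Lemma ring_ffact_shift (R : comNzRingType) (x : R) j :
  x * ring_ffact (x - 1) j = ring_ffact x j * (x - j%:R).
Proof.
transitivity (ring_ffact x j.+1); last by rewrite /ring_ffact big_ord_recr.
rewrite /ring_ffact big_ord_recl subr0; congr (_ * _).
by apply: eq_bigr => t _; rewrite /= /bump leq0n natrD opprD addrA.
Qed.

(** The recursive form of the Frobenius formula. In the Leibniz expansion
    the i-th summand on the left is the term of Delta(x) at a permutation s
    multiplied by x_i - s(i), and the sum of these factors over i does not
    depend on s. *)
Lemma vandermonde_shift (R : comNzRingType) k (x : nat -> R) :
  \sum_(i < k) x i * vandermonde k (fun j => x j - (j == i)%:R)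
    = (\sum_(i < k) x i - \sum_(i < k) (i : nat)%:R) * vandermonde k x.
Proof.
under eq_bigr => i _ do rewrite vandermonde_det /determinant big_distrr.
rewrite exchange_big vandermonde_det /determinant big_distrr /=; apply: eq_bigr => s _.
have -> : \sum_(i < k) (i : nat)%:R = \sum_(i < k) (s i : nat)%:R :> R.
  by rewrite (reindex_inj (@perm_inj _ s)).
rewrite -sumrB big_distrl /=; apply: eq_bigr => i _.
rewrite mulrCA [RHS]mulrCA; congr (_ * _).
rewrite (bigD1 i) //= [in RHS](bigD1 i) //= !mxE eqxx !mulrA; congr (_ * _).
  by rewrite ring_ffact_shift mulrC.
apply: eq_bigr => j ji; rewrite !mxE.
by rewrite (inj_eq val_inj) (negPf ji) subr0.
Qed.

Lemma vandermonde_eq0 (R : comNzRingType) k (x : nat -> R) i j :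
  (i < j < k)%N -> x i = x j -> vandermonde k x = 0.
Proof.
move=> /andP[ij jk] e; have ik := ltn_trans ij jk.
by rewrite /vandermonde (bigD1 (Ordinal ik)) //= (bigD1 (Ordinal jk)) //= e subrr !mul0r.
Qed.

Lemma eq_vandermonde (R : comNzRingType) k (x y : nat -> R) :
  (forall i, (i < k)%N -> x i = y i) -> vandermonde k x = vandermonde k y.
Proof.
move=> e; apply: eq_bigr => i _; apply: eq_bigr => j _.
by rewrite !e.
Qed.

(** |q|! times this number counts the standard fillings of the Young diagram
    with column lengths q_0 <= ... <= q_(k-1). *)
Definition frobenius k (q : nat -> nat) : rat :=
  vandermonde k (fun i => (q i + i)%:R) / \prod_(i < k) (q i + i)`!%:R.

Lemma eq_frobenius k q q' :
  (forall i, (i < k)%N -> q i = q' i) -> frobenius k q = frobenius k q'.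
Proof.
move=> e; rewrite /frobenius; congr (_ / _); first by apply: eq_vandermonde => i /e ->.
by apply: eq_bigr => i _; rewrite e.
Qed.

(** The recursion of the number of fillings over removable corners, divided by
    (|q| - 1)!. In [vandermonde_shift] for x_i = q_i + i, a column i whose last
    cell is not removable contributes 0: either x_i = 0, or lowering x_i makes
    it equal to x_(i-1). *)
Lemma frobenius_rec k (q : nat -> nat) :
    (forall i, (i.+1 < k)%N -> (q i <= q i.+1)%N) ->
  \sum_(i < k | ((if (i : nat) is i'.+1 then q i' else 0) < q i)%N)
      frobenius k (fun j => q j - (j == i))%N
    = (\sum_(i < k) q i)%:R * frobenius k q.
Proof.
move=> qmon; pose x i : rat := (q i + i)%:R.
have -> : (\sum_(i < k) q i)%:R = \sum_(i < k) x i - \sum_(i < k) (i : nat)%:R.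
  by rewrite -sumrB natr_sum; apply: eq_bigr => i _; rewrite /x natrD addrK.
rewrite mulrA -vandermonde_shift big_distrl big_mkcond /=; apply: eq_bigr => i _.
case: ifPn => [lt|]; last first.
  case: i => -[|i] ik /=; rewrite -leqNgt.
    by rewrite leqn0 /x => /eqP ->; rewrite !mul0r.
  move=> le; have qi : q i = q i.+1 by apply/eqP; rewrite eqn_leq qmon.
  rewrite (@vandermonde_eq0 _ _ _ i i.+1) ?leqnn ?ik ?mulr0 ?mul0r //.
  by rewrite /x qi eqxx addnS -natr1 addrK ltn_eqF ?leqnn // subr0.
have q_gt0 : (0 < q i)%N by case: (i : nat) lt => // i' /(leq_trans _); apply.
rewrite /frobenius (@eq_vandermonde _ _ (fun j => (q j - (j == i) + j)%:R)
  (fun j => x j - (j == i :> nat)%:R)); last first.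
  move=> j _; rewrite /x /=; case: (eqVneq j (i : nat)) => [->|_] /=;
    last by rewrite subn0 subr0.
  by rewrite -natrB; [congr _%:R|]; lia.
rewrite mulrC [in RHS]mulrAC; congr (_ * _).
rewrite (bigD1 i) //= [in RHS](bigD1 i) //= eqxx.
have -> : (q i + i)%N = (q i - 1 + i).+1 :> nat by lia.
rewrite /x (_ : (q i + i)%N = (q i - 1 + i).+1) ?factS ?natrM; last by lia.
have x0 : ((q i - 1 + i).+1%:R : rat) != 0 by rewrite pnatr_eq0.
rewrite !invfM !mulrA mulfV // mul1r; congr (_ * _^-1).
apply: eq_bigr => j ji.
by rewrite (inj_eq val_inj) (negPf ji) subn0.
Qed.

Lemma fact_neq0 k : (k`!%:R : rat) != 0.
Proof. by rewrite pnatr_eq0 -lt0n fact_gt0. Qed.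

Lemma vandermonde_recr (R : comNzRingType) k (x : nat -> R) :
  vandermonde k.+1 x = vandermonde k x * \prod_(i < k) (x k - x i).
Proof.
rewrite /vandermonde big_ord_recr /= [X in _ * X = _]big_pred0 ?mulr1; last first.
  by move=> j; rewrite ltnNge -ltnS ltn_ord.
rewrite -big_split; apply: eq_bigr => i _ /=.
by rewrite big_mkcond big_ord_recr /= ltn_ord -big_mkcond.
Qed.

Lemma frobenius_recr k q :
  frobenius k.+1 q
    = frobenius k q * (\prod_(i < k) ((q k + k)%:R - (q i + i)%:R) / (q k + k)`!%:R).
Proof.
rewrite /frobenius vandermonde_recr big_ord_recr /= invfM !mulrA.
by congr (_ * _); rewrite mulrAC.
Qed.

(** Reversing the order of the points and reflecting them each change the sign
    of every factor. *)
Lemma vandermonde_rev (R : comNzRingType) k (x : nat -> R) c :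
  vandermonde k (fun i => c - x (k - i.+1)%N) = vandermonde k x.
Proof.
have K (i : 'I_k) : (k - (k - i.+1).+1 = i)%N by have := ltn_ord i; lia.
rewrite /vandermonde (reindex_inj rev_ord_inj) /=.
under eq_bigr => i _.
  rewrite (reindex_inj rev_ord_inj) /=.
  under eq_bigr => j _.
    have -> : c - x (k - (k - j.+1).+1)%N - (c - x (k - (k - i.+1).+1)%N) = x i - x j.
      by rewrite !K opprB addrC addrA subrK.
  over.
  rewrite big_mkcond.
over.
rewrite exchange_big /=; apply: eq_bigr => i _; rewrite [RHS]big_mkcond.
apply: eq_bigr => j _; congr (if _ then _ else _).
by have := ltn_ord i; have := ltn_ord j; lia.
Qed.

Lemma frobenius_empty k : frobenius k (fun=> 0%N) = 1.
Proof.
elim: k => [|k IH]; first by rewrite /frobenius /vandermonde !big_ord0 divr1.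
rewrite frobenius_recr IH mul1r add0n fact_prod natr_prod.
rewrite big_add1 /= big_mkord (reindex_inj rev_ord_inj) /=.
under eq_bigr => i _ do rewrite add0n -natrB ?leq_subr // subKn //.
by rewrite divff // -natr_prod pnatr_eq0 -lt0n prodn_gt0.
Qed.

(** * Column heights and the two-sided path count *)

(** Diagrams are given by their column heights, as functions on nat in order
    that neighbouring columns can be compared without casts. *)
Definition add_cell (h : nat -> nat) j := fun i => (h i + (i == j))%N.
Definition del_cell (h : nat -> nat) j := fun i => (h i - (i == j))%N.

Definition is_part m (h : nat -> nat) : bool :=
  [forall i : 'I_m, h i.+1 <= h i]%N.

(** The height that column j may not exceed: that of its left neighbour, or n
    for the first column. *)
Definition prev n (h : nat -> nat) j := if j is j'.+1 then h j' else n.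

Lemma is_partP m h :
  reflect (forall i, (i < m)%N -> (h i.+1 <= h i)%N) (is_part m h).
Proof.
apply: (iffP forallP) => [p i im|p i]; first exact: (p (Ordinal im)).
exact: p.
Qed.

Lemma is_part_le m h i j : is_part m h -> (i <= j <= m)%N -> (h j <= h i)%N.
Proof.
move=> /is_partP p /andP[]; elim: j => [|j IH]; first by rewrite leqn0 => /eqP->.
rewrite leq_eqVlt => /orP[/eqP-> //|ij] jm.
by apply: leq_trans (p _ jm) (IH _ (ltnW jm)).
Qed.

(** Seen from below, column j of h can receive a cell; seen from above, the
    resulting last cell of column j is removable. *)
Lemma is_part_add_cell m n h j : (j < m)%N -> (h j < n)%N ->
  is_part m (add_cell h j) && (h j.+1 <= h j)%N = is_part m h && (h j < prev n h j)%N.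
Proof.
move=> jm jn; apply/andP/andP=> -[/is_partP p q]; split.
- apply/is_partP => i im; have := p i im; rewrite /add_cell.
  have [->|ne] := eqVneq i j; first by [].
  by case: eqP => _; lia.
- case: j {p} jm jn q (p j.-1) => [|j] //= jm jn q p.
  by have := p (ltnW jm); rewrite /add_cell eqxx; case: eqP; lia.
- apply/is_partP => i im; have := p i im; rewrite /add_cell.
  have [->|ne] := eqVneq i j; first by case: eqP; lia.
  by case: eqP => [e|_]; [move: q; rewrite -e /=|]; lia.
- exact: p.
Qed.

Section Transfer.
Variables (m n : nat).
Local Notation T := {ffun 'I_m -> 'I_n.+1}.

Definition height (c : T) (i : nat) : nat :=
  if insub i is Some j then c j else 0.

Definition of_height (h : nat -> nat) : T := [ffun j : 'I_m => inord (h j)].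

Lemma heightE (c : T) (i : 'I_m) : height c i = c i.
Proof. by rewrite /height valK. Qed.

Lemma height_out (c : T) i : (m <= i)%N -> height c i = 0.
Proof. by move=> mi; rewrite /height insubN // -leqNgt. Qed.

Lemma height_le (c : T) i : (height c i <= n)%N.
Proof. by rewrite /height; case: insub => // j; rewrite -ltnS. Qed.

Lemma height_of h i : (i < m)%N -> (h i <= n)%N -> height (of_height h) i = h i.
Proof. by move=> im hn; rewrite (heightE _ (Ordinal im)) ffunE inordK. Qed.

Lemma height_inj (c d : T) : (forall i, (i < m)%N -> height c i = height d i) -> c = d.
Proof.
by move=> e; apply/ffunP => i; apply: val_inj; rewrite /= -!heightE e.
Qed.

(** Let u count the paths of added cells that start from sources of strength s
    and let g count the paths to the full rectangle. In the sum of u * g over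
    all diagrams, replacing u by its recursion and moving each removed cell to
    the other factor gives back the same sum without the term of the full
    rectangle, plus the sum of s * g. Hence the term of the full rectangle is
    the sum of s * g. *)
Lemma path_sum (s u g : (nat -> nat) -> rat) :
    (forall h h', (forall i, (i < m)%N -> h i = h' i) -> u h = u h') ->
    (forall h h', (forall i, (i < m)%N -> h i = h' i) -> g h = g h') ->
    (forall h, is_part m h -> (forall i, (h i <= n)%N) -> h m = 0%N ->
      u h = \sum_(j < m | (h j.+1 < h j)%N) u (del_cell h j) + s h) ->
    (forall h, is_part m h -> (forall i, (h i <= n)%N) ->
      (exists2 i, (i < m)%N & (h i < n)%N) ->
      \sum_(j < m | (h j < prev n h j)%N) g (add_cell h j) = g h) ->
  u (fun=> n) * g (fun=> n)
    = \sum_(c : T | is_part m (height c)) s (height c) * g (height c).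
Proof.
move=> uE gE urec grec.
pose P (c : T) := is_part m (height c).
pose full : T := [ffun=> ord_max].
have hfull i : (i < m)%N -> height full i = n.
  by move=> im; rewrite (heightE _ (Ordinal im)) ffunE.
have Pfull : P full.
  by apply/is_partP => i im; rewrite [X in (_ <= X)%N]hfull // height_le.
have step : \sum_(c | P c) \sum_(j < m | (height c j.+1 < height c j)%N)
      u (del_cell (height c) j) * g (height c)
    = \sum_(c | P c && (c != full)) u (height c) * g (height c).
  rewrite (exchange_big_dep predT) //=.
  transitivity (\sum_(c | P c) \sum_(j < m | (height c j < prev n (height c) j)%N)
      u (height c) * g (add_cell (height c) j)); last first.
    rewrite [RHS]big_mkcondr; apply: eq_bigr => c Pc; rewrite -big_distrr /=.
    have [->|ne] /= := eqVneq c full.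
      rewrite big_pred0 ?mulr0 // => -[[|j] jm] /=; rewrite !hfull ?ltnn //.
      exact: ltnW.
    rewrite grec //; first by move=> i; apply: height_le.
    have /existsP[i] : [exists i, c i != ord_max].
      apply: contraR ne; rewrite negb_exists => /forallP e; apply/eqP/ffunP => i.
      by rewrite ffunE; apply/eqP; have := e i; rewrite negbK.
    move=> ci; exists i; first exact: ltn_ord.
    rewrite heightE ltn_neqAle -ltnS ltn_ord andbT.
    by apply: contra ci => /eqP e; apply/eqP/val_inj.
  rewrite [RHS](exchange_big_dep predT) //=; apply: eq_bigr => j _.
  pose up (c : T) : T := of_height (add_cell (height c) j).
  pose dn (c : T) : T := of_height (del_cell (height c) j).
  have dnE (c : T) i : (i < m)%N -> height (dn c) i = del_cell (height c) j i.
    move=> im; rewrite height_of // /del_cell.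
    by have := height_le c i; lia.
  have upE (c : T) i : (height c j < n)%N -> height (up c) i = add_cell (height c) j i.
    move=> cj; have [im|mi] := ltnP i m.
      rewrite height_of // /add_cell.
      by have := height_le c i; case: eqP => [->|]; lia.
    by rewrite /add_cell !height_out // gtn_eqF // (leq_trans _ mi).
  (* pair a diagram having a last cell in column j with the one without it *)
  rewrite (reindex_onto up dn); last first.
    move=> c /andP[_ cj]; apply: height_inj => i im.
    rewrite upE; last first.
      by rewrite dnE // /del_cell eqxx; have := height_le c j; lia.
    by rewrite /add_cell dnE // /del_cell; case: eqP => [->|]; lia.
  apply: eq_big => [c|c /andP[/andP[Pc cj] /eqP dc]]; last first.
    congr (_ * _).
      apply: uE => i im; rewrite -dnE // dc //.
    apply: gE => i im; apply: upE.
    rewrite -{1}dc dnE // /del_cell eqxx; have := height_le (up c) j; lia.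
  (* a full column wraps around to height 0 under inord, so that its image
     has no removable cell in column j *)
  have [cj|cj] := ltnP (height c j) n; last first.
    have -> : (height (up c) j = 0)%N.
      rewrite heightE ffunE /add_cell eqxx addn1 [val _]val_insubd ltnS.
      by rewrite ltnNge cj.
    have pn : (prev n (height c) j <= n)%N.
      by case: (j : nat) => //= i; apply: height_le.
    by rewrite ltn0 andbF /= [X in _ = _ && X]ltnNge (leq_trans pn cj) andbF.
  have -> : dn (up c) == c.
    by apply/eqP/height_inj => i im; rewrite dnE // /del_cell upE // /add_cell; lia.
  rewrite andbT /P -is_part_add_cell // !upE // /add_cell eqxx gtn_eqF // addn0 addn1 ltnS.
  congr (_ && _); apply: eq_forallb => i; rewrite !upE //.
have := erefl (\sum_(c | P c) u (height c) * g (height c)).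
rewrite {1}(bigID (pred1 full)) /= (big_pred1 full); last first.
  by move=> c; apply/andP/eqP => [[_ /eqP]|->]; rewrite ?eqxx.
rewrite (@uE _ (fun=> n)) // (@gE _ (fun=> n)) //.
under [in RHS]eq_bigr => c Pc.
  rewrite urec ?height_out //; last by move=> i; apply: height_le.
  rewrite mulrDl big_distrl /=.
over.
by rewrite big_split /= step addrC => /addrI.
Qed.

End Transfer.

(** * The battery as a poset *)

Section Battery.
Local Open Scope nat_scope.
Variables (m n a p : nat).
Hypothesis pm : p < m.
Local Notation A := ('I_m * 'I_n + 'I_a)%type.

(** inl (j, i) is the cell in column j and row i of the rectangle, and inr k the
    k-th added cell from the top; the added column sits on column p. *)
Definition battery_rel (x y : A) : bool :=
  match x, y with
  | inl (j, i), inl (j', i') => (i == i') && (j < j') || (j == j') && (i < i')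
  | inl _, inr _ => false
  | inr _, inl (j, _) => j == p :> nat
  | inr k, inr k' => k < k'
  end.

(** The first h_j cells of each column j and the first b added cells. This is
    an order ideal when h is a diagram and either b = a or h_p = 0. *)
Definition ideal (h : nat -> nat) (b : nat) : {set A} :=
  [set x : A | match x with inl (j, i) => i < h j | inr k => k < b end].

Definition num_fillings h b := #|linext battery_rel (m * n + a).-1 (ideal h b)|.

Lemma eq_num_fillings h h' b :
  (forall i, i < m -> h i = h' i) -> num_fillings h b = num_fillings h' b.
Proof.
move=> e; rewrite /num_fillings; congr #|pred_of_set (linext _ _ _)|.
by apply/setP => -[[j i]|k]; rewrite !inE // e.
Qed.

Lemma num_fillings_empty : num_fillings (fun=> 0) 0 = 1.
Proof.
rewrite /num_fillings (_ : ideal _ _ = set0) ?card_linext0 //.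
by apply/setP => -[[j i]|k]; rewrite !inE.
Qed.

Section Rec.
Variables (h : nat -> nat) (b : nat).
Hypotheses (hpart : is_part m h) (hn : forall i, h i <= n) (hm : h m = 0)
  (ba : b <= a).
Local Notation S := (ideal h b).
Local Notation maximal x := [forall y in S, ~~ battery_rel x y].

Lemma ideal_max_rect (j : 'I_m) (i : 'I_n) :
  (inl (j, i) \in S) && maximal (inl (j, i))
    = (h j.+1 < h j) && (i == (h j).-1 :> nat).
Proof.
apply/andP/andP => [[]|[hj /eqP ie]].
  rewrite inE => ij /forall_inP mx.
  have ie : i.+1 = h j.
    apply/eqP; move: ij; rewrite leq_eqVlt => /orP[//|lt].
    have i1n : i.+1 < n by apply: leq_trans lt (hn _).
    by have := mx (inl (j, Ordinal i1n)); rewrite inE /= lt eqxx ltnSn orbT => /(_ isT).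
  split; last by rewrite -ie.
  rewrite ltnNge; apply/negP => le.
  have j1m : j.+1 < m.
    rewrite ltn_neqAle ltn_ord andbT; apply/eqP => e.
    by move: le; rewrite e hm; move: ij; lia.
  have := mx (inl (Ordinal j1m, i)).
  by rewrite inE /= (leq_trans ij le) eqxx ltnSn => /(_ isT).
split; first by rewrite inE ie; lia.
apply/forall_inP => -[[j' i']|//]; rewrite inE /= => ij'.
rewrite negb_or !negb_and -!leqNgt; apply/andP; split.
  have [e|//] := eqVneq i i'; have [//|jj'] := leqP j' j; move: ij'.
  have := is_part_le (i := j.+1) (j := j') hpart.
  by rewrite jj' ltnW // -e => /(_ isT); lia.
have [e|//] := eqVneq j j'; move: ij'; rewrite -e; lia.
Qed.

Lemma ideal_max_column (k : 'I_a) :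
  (inr k \in S) && maximal (inr k) = (k.+1 == b) && (h p == 0).
Proof.
apply/andP/andP => [[]|[/eqP kb /eqP hp]].
  rewrite inE => kb /forall_inP mx; split.
    move: kb; rewrite leq_eqVlt => /orP[//|lt].
    have k1a : k.+1 < a by apply: leq_trans lt ba.
    by have := mx (inr (Ordinal k1a)); rewrite inE /= lt ltnSn => /(_ isT).
  rewrite -leqn0 leqNgt; apply/negP => hp.
  have n0 : 0 < n by apply: leq_trans hp (hn _).
  have := mx (inl (Ordinal pm, Ordinal n0)).
  by rewrite inE /= hp eqxx => /(_ isT).
split; first by rewrite inE -kb.
apply/forall_inP => -[[j i]|k']; rewrite inE /= => lt.
  by apply/eqP => e; move: lt; rewrite e hp.
by rewrite -leqNgt; lia.
Qed.

(** The largest entry of an ideal sits at a removable corner of h, or at the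
    last added cell if nothing below it is filled. *)
Lemma num_fillings_rec : (0 < h 0) || (0 < b) ->
  num_fillings h b = \sum_(j < m | h j.+1 < h j) num_fillings (del_cell h j) b
            + (if (0 < b) && (h p == 0) then num_fillings h b.-1 else 0).
Proof.
move=> ne; rewrite {1}/num_fillings card_linext_rec; first last.
- case/orP: ne => [h0|b0]; apply/set0Pn.
    have m0 : 0 < m by apply: leq_ltn_trans pm.
    have n0 : 0 < n by apply: leq_trans h0 (hn _).
    by exists (inl (Ordinal m0, Ordinal n0)); rewrite inE.
  have a0 : 0 < a by apply: leq_trans b0 ba.
  by exists (inr (Ordinal a0)); rewrite inE.
- apply: leq_trans (leqSpred _).
  by rewrite (leq_trans (max_card _)) // card_sum card_prod !card_ord.
rewrite big_mkcond big_sumType /=; congr (_ + _).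
  transitivity (\sum_(j < m) \sum_(i < n) if (inl (j, i) \in S)
      && maximal (inl (j, i)) then
        #|linext battery_rel (m * n + a).-1 (S :\ inl (j, i))| else 0).
    by rewrite pair_bigA; apply: eq_bigr => -[].
  rewrite [RHS]big_mkcond /=.
  apply: eq_bigr => j _.
  under eq_bigr => i _ do rewrite ideal_max_rect.
  case: ifP => hj; last by rewrite big1.
  have jn : (h j).-1 < n by have := hn j; lia.
  rewrite -big_mkcond (big_pred1 (Ordinal jn)) //.
  congr #|pred_of_set (linext _ _ _)|; apply/setP => -[[j' i']|k]; rewrite !inE //=.
  rewrite [_ == _]xpair_eqE /del_cell -!(inj_eq val_inj) /=.
  by case: (eqVneq (j' : nat) j) => [->|] /=; lia.
under eq_bigr => k _ do rewrite ideal_max_column.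
case: ifP => [/andP[b0 ->]|bh]; last first.
  rewrite big1 // => k _; case: ifP => // /andP[/eqP kb e].
  by move: bh; rewrite -kb e.
have ka : b.-1 < a by lia.
rewrite -big_mkcond (big_pred1 (Ordinal ka)) => [|k]; last first.
  by rewrite andbT [pred1 _ _]/= -(inj_eq val_inj) /=; lia.
congr #|pred_of_set (linext _ _ _)|; apply/setP => -[[j' i']|k]; rewrite !inE //=.
by rewrite [_ == _](inj_eq inr_inj) -(inj_eq val_inj) /=; lia.
Qed.
End Rec.
End Battery.

(** * Fillings of the part below the cut *)

(** The column heights of a diagram decrease, while [frobenius] takes them in
    increasing order. *)
Definition frobenius_cols p h := frobenius p (fun i => h (p - i.+1)%N).

Lemma frobenius_cols_rec p h : is_part p h -> h p = 0%N ->
  \sum_(j < p | (h j.+1 < h j)%N) frobenius_cols p (del_cell h j)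
    = (\sum_(j < p) h j)%:R * frobenius_cols p h.
Proof.
move=> /is_partP hpart hp; rewrite [X in X%:R](reindex_inj rev_ord_inj) /=.
rewrite -(@frobenius_rec p (fun i => h (p - i.+1)%N)); last first.
  move=> i ip; have := hpart (p - i.+2)%N; rewrite subnSK //; apply.
  by lia.
rewrite (reindex_inj rev_ord_inj) /=; apply: eq_big => [i|i _].
  rewrite subnSK //; case: i => -[|i] ip //=; by rewrite subn0 hp.
apply: eq_frobenius => j jp; rewrite /del_cell; congr (_ - nat_of_bool _)%N.
by have := ltn_ord i; lia.
Qed.

Lemma is_part_del_cell m h j : is_part m h -> (h j.+1 < h j)%N ->
  is_part m (del_cell h j).
Proof.
move=> /is_partP hpart hj; apply/is_partP => i /hpart; rewrite /del_cell.
have [->|ne] := eqVneq i j; first by lia.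
by lia.
Qed.

Lemma sum_del_cell m (h : nat -> nat) (j : 'I_m) : (0 < h j)%N ->
  (\sum_(i < m) h i = (\sum_(i < m) del_cell h j i).+1)%N.
Proof.
move=> hj; rewrite (bigD1 j) //= [in RHS](bigD1 j) //= /del_cell eqxx.
rewrite -addSn subn1 prednK //; congr (_ + _)%N; apply: eq_bigr => i ij.
by rewrite (inj_eq val_inj) (negPf ij) subn0.
Qed.

Lemma sum_add_cell m (h : nat -> nat) (j : 'I_m) :
  (\sum_(i < m) add_cell h j i = (\sum_(i < m) h i).+1)%N.
Proof.
rewrite (bigD1 j) //= [in RHS](bigD1 j) //= /add_cell eqxx addn1.
rewrite -addSn; congr (_ + _)%N; apply: eq_bigr => i ij.
by rewrite (inj_eq val_inj) (negPf ij) addn0.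
Qed.

(** To the left of column p the diagram and the added chain are independent, so
    their fillings are shuffled freely: the binomial coefficient of |h| + b over
    b times the |h|! of the Frobenius formula is (|h| + b)! / b!. *)
Lemma num_fillings_low m n a p h b : (p < m)%N -> is_part m h ->
    (forall i, h i <= n)%N -> h p = 0%N -> (b <= a)%N ->
  (num_fillings m n a p h b)%:R
    = ((\sum_(i < p) h i + b)`!%:R / b`!%:R) * frobenius_cols p h.
Proof.
move=> pm; have [N] := ubnP (\sum_(i < p) h i + b)%N.
elim: N h b => // N IH h b; rewrite ltnS => hN hpart hn hp ba.
have h0 i : (p <= i <= m)%N -> h i = 0%N.
  by move=> /(is_part_le hpart); rewrite hp leqn0 => /eqP.
have hm : h m = 0%N by apply: h0; rewrite leqnn ltnW.
have part_p : is_part p h.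
  apply/is_partP => i ip; move/is_partP: hpart; apply; exact: ltn_trans pm.
have [|ne] := boolP (~~ ((0 < h 0) || (0 < b))%N).
  rewrite negb_or -!leqNgt !leqn0 => /andP[/eqP h00 /eqP ->].
  have h_0 i : (i <= m)%N -> h i = 0%N.
    by move=> im; apply/eqP; rewrite -leqn0 -h00 (is_part_le hpart).
  rewrite (@eq_num_fillings _ _ _ _ h (fun=> 0%N)) => [|i /ltnW/h_0 //].
  rewrite num_fillings_empty big1 => [|i _]; last first.
    by apply: h_0; rewrite ltnW // (ltn_trans _ pm).
  rewrite divff ?fact_neq0 // mul1r -(frobenius_empty p); apply: eq_frobenius => i ip.
  by rewrite h_0 //; lia.
(* (s + b)! = K! * (s + b): corners of h account for the share s of the
   factor s + b, and the last added cell for the share b *)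
set s := (\sum_(i < p) h i)%N in hN *; pose K := (s + b).-1.
rewrite num_fillings_rec //; last by move: ne; rewrite negbK.
rewrite natrD natr_sum.
have -> : \sum_(j < m | (h j.+1 < h j)%N) (num_fillings m n a p (del_cell h j) b)%:R
    = \sum_(j < p | (h j.+1 < h j)%N) (num_fillings m n a p (del_cell h j) b)%:R :> rat.
  rewrite [RHS](big_ord_widen_cond m (fun j => h j.+1 < h j)%N
    (fun j => (num_fillings m n a p (del_cell h j) b)%:R)) ?(ltnW pm) //.
  apply: eq_bigl => j /=; have [jp|jp] := ltnP j p; rewrite ?andbT ?andbF; [reflexivity|].
  have -> : h j = 0%N by apply: h0; rewrite jp ltnW. by rewrite ltn0.
have -> : \sum_(j < p | (h j.+1 < h j)%N) (num_fillings m n a p (del_cell h j) b)%:R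
    = K`!%:R / b`!%:R * (s%:R * frobenius_cols p h).
  rewrite -frobenius_cols_rec // big_distrr; apply: eq_bigr => j hj /=.
  have sE := @sum_del_cell p h j (leq_ltn_trans (leq0n _) hj).
  rewrite IH //.
  - by rewrite /K /s sE.
  - by rewrite /s sE in hN.
  - exact: is_part_del_cell.
  - by move=> i; rewrite (leq_trans _ (hn i)) // leq_subr.
  - by rewrite /del_cell hp.
have -> : (if (0 < b)%N && (h p == 0%N) then num_fillings m n a p h b.-1 else 0%N)%:R
    = K`!%:R / b`!%:R * (b%:R * frobenius_cols p h).
  rewrite hp eqxx andbT {}/K; case: b ba hN {ne} => [|b] ba hN /=.
    by rewrite mul0r mulr0.
  rewrite (IH h b) //; [|by rewrite -/s; lia|exact: ltnW].
  rewrite addnS /= factS natrM.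
  by field; rewrite fact_neq0 nat1r pnatr_eq0.
have sb : (0 < s + b)%N.
  have [b0|b0] := posnP b; last by lia.
  move: ne; rewrite negbK b0 orbF => h00.
  have p0 : (0 < p)%N by rewrite lt0n; apply: contraL h00 => /eqP p0; rewrite -p0 hp.
  by rewrite /s (bigD1 (Ordinal p0)) //=; lia.
rewrite -mulrDr -mulrDl -natrD -(prednK sb) -/K factS natrM.
by field; rewrite fact_neq0.
Qed.

(** * Fillings of the part above the cut *)

(** The number of ways to fill the complement of h in the rectangle: turned
    upside down it is the diagram of the increasing column lengths n - h_i. *)
Definition num_completions m n (h : nat -> nat) : rat :=
  (m * n - \sum_(i < m) h i)`!%:R * frobenius m (fun i => n - h i)%N.

Lemma num_completions_full m n : num_completions m n (fun=> n) = 1.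
Proof.
rewrite /num_completions sum_nat_const card_ord subnn fact0 mul1r -(frobenius_empty m).
by apply: eq_frobenius => i _; rewrite subnn.
Qed.

Lemma eq_num_completions m n (h h' : nat -> nat) :
    (forall i, (i < m)%N -> h i = h' i) ->
  num_completions m n h = num_completions m n h'.
Proof.
move=> e; rewrite /num_completions (eq_bigr (fun i : 'I_m => h' i)) => [|i _];
  last by rewrite e.
by congr (_ * _); apply: eq_frobenius => i /e ->.
Qed.

Lemma num_completions_rec m n h : is_part m h -> (forall i, h i <= n)%N ->
    (exists2 i, (i < m)%N & (h i < n)%N) ->
  \sum_(j < m | (h j < prev n h j)%N) num_completions m n (add_cell h j)
    = num_completions m n h.
Proof.
move=> /is_partP hpart hn [i0 i0m hi0].
have E : (\sum_(i < m) (n - h i) = m * n - \sum_(i < m) h i)%N.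
  by rewrite sumnB // sum_nat_const card_ord.
have pos : (0 < m * n - \sum_(i < m) h i)%N.
  by rewrite -E (bigD1 (Ordinal i0m)) //=; lia.
rewrite /num_completions -(prednK pos) factS natrM -mulrA mulrCA.
have := @frobenius_rec m (fun i => n - h i)%N.
rewrite E prednK // => <-; last by move=> i im; rewrite leq_sub2l // hpart // ltnW.
rewrite big_distrr /=; apply: eq_big => [[[|j] jm]|j hj] /=.
- by rewrite subn_gt0.
- by have := hn j; have := hn j.+1; lia.
congr (_`!%:R * _); first by rewrite sum_add_cell subnS.
by apply: eq_frobenius => i _; rewrite /add_cell subnDA.
Qed.

(** The points n - h_i + i are the reflection at n + p - 1 of those that belong
    to h itself, which explains why the formula of h comes out of that of its
    complement. *)
Lemma vandermonde_complement p n h : (forall i, h i <= n)%N ->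
  vandermonde p (fun i => (n - h i + i)%:R)
    = frobenius_cols p h * \prod_(j < p) (h j + (p - j.+1))`!%:R :> rat.
Proof.
move=> hn; have prodE : \prod_(j < p) (h j + (p - j.+1))`!%:R
    = \prod_(i < p) (h (p - i.+1)%N + i)`!%:R :> rat.
  rewrite (reindex_inj rev_ord_inj); apply: eq_bigr => i _ /=.
  by congr (_ + _)`!%:R; have := ltn_ord i; lia.
rewrite prodE /frobenius_cols /frobenius divfK; last first.
  by apply/prodf_neq0 => i _; apply: fact_neq0.
(* the reflection constant is the sum of n - h_i + i and h_i + p - 1 - i *)
rewrite -[RHS](vandermonde_rev _ _ (n%:R + p%:R - 1)); apply: eq_vandermonde => i ip.
have -> : (p - (p - i.+1).+1 = i)%N by lia.
rewrite natrD natrB // natrD natrB // -natr1; ring.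
Qed.

(** By induction on the number d of empty columns to the right. Adding column
    k = p + d multiplies both sides by the differences between its point n + k
    and the earlier ones; only the p differences with nonempty columns depend
    on h, and these prolong the factorials (k - 1 - j + h_j)!. *)
Lemma frobenius_complement p n h d : (forall i, h i <= n)%N ->
    (forall i, (i < d)%N -> h (p + i)%N = 0)%N ->
  frobenius (p + d) (fun i => n - h i)%N
    = frobenius (p + d) (fun=> n)
      * (\prod_(j < p) ((p + d - j.+1 + h j)`!%:R / (p + d - j.+1)`!%:R
                        * ((n + j)`!%:R / (n - h j + j)`!%:R)))
      * frobenius_cols p h.
Proof.
move=> hn; elim: d => [|d IH] h0.
  have nz (f : nat -> nat) : \prod_(j < p) (f j)`!%:R != 0 :> rat.
    by apply/prodf_neq0 => i _; apply: fact_neq0.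
  have F0 : frobenius_cols p (fun=> 0%N) = 1 by apply: frobenius_empty.
  have V0 : vandermonde p (fun i => (n + i)%:R) = \prod_(j < p) (p - j.+1)`!%:R :> rat.
    have := @vandermonde_complement p n (fun=> 0%N) (fun=> leq0n _).
    by rewrite F0 mul1r => <-; apply: eq_vandermonde => i _; rewrite subn0.
  rewrite addn0 /frobenius vandermonde_complement // V0 big_split /= !prodf_div.
  under [\prod_(j < p) (h j + _)`!%:R]eq_bigr => j _ do rewrite addnC.
  field; rewrite !nz.
  by rewrite (nz (fun j => n - h j + j)%N) (nz (fun j => p - j.+1)%N).
rewrite !addnS !frobenius_recr IH; last by move=> i id; apply/h0/ltnW.
set k := (p + d)%N; have pk : (p <= k)%N by apply: leq_addr.
have hk : h k = 0%N by apply: h0.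
rewrite hk subn0.
have -> : \prod_(i < k) ((n + k)%:R - (n - h i + i)%:R)
   = \prod_(i < k) ((n + k)%:R - (n + i)%:R)
     * \prod_(j < p) ((k - j + h j)%:R / (k - j)%:R) :> rat.
  rewrite (big_ord_widen k (fun j => (k - j + h j)%:R / (k - j)%:R)) //.
  rewrite [X in _ * X]big_mkcond -big_split /=; apply: eq_bigr => i _.
  have ik := ltn_ord i.
  have -> : (n + k)%:R - (n + i)%:R = (k - i)%:R :> rat.
    by rewrite -natrB ?leq_add2l 1?ltnW //; congr _%:R; lia.
  have -> : (n + k)%:R - (n - h i + i)%:R = (k - i + h i)%:R :> rat.
    by rewrite -natrB; [congr _%:R|]; have := hn i; lia.
  case: ltnP => ip.
    by rewrite mulrC divfK // pnatr_eq0; lia.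
  have := h0 (i - p)%N; rewrite subnKC // => ->; first by rewrite addn0 mulr1.
  by rewrite ltn_subLR // addnS ltnW.
have -> : \prod_(j < p) ((k.+1 - j.+1 + h j)`!%:R / (k.+1 - j.+1)`!%:R
                         * ((n + j)`!%:R / (n - h j + j)`!%:R))
  = \prod_(j < p) ((k - j + h j)%:R / (k - j)%:R)
    * \prod_(j < p) ((k - j.+1 + h j)`!%:R / (k - j.+1)`!%:R
                         * ((n + j)`!%:R / (n - h j + j)`!%:R)) :> rat.
  rewrite -big_split; apply: eq_bigr => j _ /=.
  have jk : (j < k)%N by apply: leq_trans pk.
  rewrite subSS -(subnSK jk) addSn !factS !natrM.
  by field; rewrite !fact_neq0 nat1r pnatr_eq0.
ring.
Qed.

Lemma num_completions_low m n p h : (p <= m)%N -> is_part m h -> (forall i, h i <= n)%N ->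
    h p = 0%N ->
  num_completions m n h = num_completions m n (fun=> 0%N)
    * ((m * n - \sum_(j < p) h j)`!%:R / (m * n)`!%:R
       * (\prod_(j < p) ((m - j.+1 + h j)`!%:R / (m - j.+1)`!%:R
                        * ((n + j)`!%:R / (n - h j + j)`!%:R)))
       * frobenius_cols p h).
Proof.
move=> pm hpart hn hp.
have h0 i : (p <= i <= m)%N -> h i = 0%N.
  by move=> /(is_part_le hpart); rewrite hp leqn0 => /eqP.
have hd i : (i < m - p)%N -> h (p + i)%N = 0%N by move=> im; apply: h0; lia.
have := frobenius_complement hn hd; rewrite subnKC // /num_completions => ->.
rewrite big1_eq subn0.
have -> : (\sum_(i < m) h i = \sum_(i < p) h i)%N.
  rewrite [RHS](big_ord_widen m h) // [RHS]big_mkcond; apply: eq_bigr => i _.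
  by case: ltnP => // pi; rewrite h0 // pi ltnW.
rewrite (eq_frobenius (k := m) (q := fun=> (n - 0)%N) (q' := fun=> n)) => [|i _];
  last by rewrite subn0.
by field; rewrite fact_neq0.
Qed.

(** * Cutting the battery at the bottom of the added column *)

Lemma battery_shape0 m n k : battery_shape m n 0 k = rect_shape m n.
Proof.
by apply/fsetP => c; rewrite !inE; case: imfsetP => [[x]|]; rewrite ?orbF.
Qed.

Lemma num_syt_battery m n a p : (p < m)%N -> (0 < m * n + a)%N ->
  num_syt (battery_shape m n a p.+1) = num_fillings m n a p (fun=> n) a.
Proof.
move=> pm pos.
pose cellof (x : 'I_m * 'I_n + 'I_a) : cell :=
  match x with
  | inl (j, i) => (i.+1%:Z, j.+1%:Z)
  | inr k => (1 - (a - k)%:Z, p.+1%:Z)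
  end.
have ideal_full : @ideal m n a (fun=> n) a = [set: 'I_m * 'I_n + 'I_a].
  by apply/setP => -[[j i]|k]; rewrite !inE ltn_ord.
rewrite /num_fillings ideal_full; apply: (@num_syt_linext _ _ _ _ cellof).
- by rewrite card_sum card_prod !card_ord prednK.
- move=> [[j i]|k] [[j' i']|k'] //= [] => [e1 e2|||e].
  + by congr (inl (_, _)); apply: val_inj; rewrite /=; lia.
  + by move=> e _; have := ltn_ord k'; lia.
  + by move=> e _; have := ltn_ord k; lia.
  + by congr inr; apply: val_inj => /=; have := ltn_ord k; have := ltn_ord k'; lia.
- move=> c; rewrite in_fsetU; apply/orP/codomP.
    case=> [/imfset2P[i /= im [j /= jm ->]]|/imfsetP[b /= bm ->]].
      move: im jm; rewrite !mem_iota => im jm.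
      have i1 : (i.-1 < n)%N by lia.
      have j1 : (j.-1 < m)%N by lia.
      by exists (inl (Ordinal j1, Ordinal i1)); congr (_, _); rewrite /=; lia.
    move: bm; rewrite mem_iota => bm.
    have b1 : (a - b < a)%N by lia.
    by exists (inr (Ordinal b1)); congr (_, _); rewrite /=; lia.
  move=> [[[j i]|k] ->]; [left|right].
    apply/imfset2P; exists i.+1; [|exists j.+1]; rewrite //= mem_iota;
    by have := ltn_ord i; have := ltn_ord j; lia.
  by apply/imfsetP; exists (a - k)%N; rewrite //= mem_iota; have := ltn_ord k; lia.
- move=> [[j i]|k] [[j' i']|k']; rewrite /before /=.
  + by rewrite -!(inj_eq val_inj) /=; lia.
  + by have := ltn_ord k'; lia.
  + by have := ltn_ord k; lia.
  + by have := ltn_ord k; have := ltn_ord k'; lia.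
Qed.

(** [path_sum] with the empty diagram as the only source. *)
Lemma num_syt_rect m n : (0 < m)%N -> (0 < n)%N ->
  (num_syt (rect_shape m n))%:R = num_completions m n (fun=> 0%N).
Proof.
move=> m0 n0; rewrite -(battery_shape0 _ _ 1) num_syt_battery ?addn0 ?muln_gt0 ?m0 //.
have zero h : is_part m h -> h 0%N = 0%N -> forall i, (i <= m)%N -> h i = 0%N.
  by move=> hpart h0 i im; apply/eqP; rewrite -leqn0 -h0 (is_part_le hpart).
have := @path_sum m n (fun h => if h 0%N == 0%N then 1 else 0)
  (fun h => (num_fillings m n 0 0 h 0)%:R) (num_completions m n).
rewrite num_completions_full mulr1 => ->.
- pose c0 : {ffun 'I_m -> 'I_n.+1} := [ffun=> ord0].
  have c0E i : height c0 i = 0%N by rewrite /height; case: insub => // j; rewrite ffunE.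
  rewrite (bigD1 c0) /=; last by apply/is_partP => i _; rewrite !c0E.
  rewrite c0E eqxx mul1r big1 => [|c /andP[cpart /eqP cN]].
    by rewrite addr0; apply: eq_num_completions => i _; rewrite c0E.
  case: eqP => [h0|]; rewrite ?mul0r //; case: cN; apply: height_inj => i im.
  by rewrite c0E (zero _ cpart h0) // ltnW.
- by move=> h h' e; congr (_%:R); apply: eq_num_fillings.
- by move=> h h' e; apply: eq_num_completions.
- move=> h hpart hn hm; case: eqP => h0.
    rewrite big_pred0 => [|j]; last by rewrite [h j](zero h) ?ltn0 // ltnW.
    rewrite add0r (@eq_num_fillings _ _ _ _ h (fun=> 0%N)) ?num_fillings_empty // => i im.
    by rewrite (zero h) // ltnW.
  rewrite num_fillings_rec //; last by rewrite lt0n; move/eqP: h0 => ->.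
  by rewrite addn0 addr0 natr_sum.
- by move=> h; apply: num_completions_rec.
Qed.

(** The sources are the diagrams at the moment when the last added cell is
    filled; that step is possible exactly when column p is empty. *)
Lemma num_syt_battery_sum m n a p : (p < m)%N -> (0 < a)%N ->
  (num_syt (battery_shape m n a p.+1))%:R
    = \sum_(c : {ffun 'I_m -> 'I_n.+1} | is_part m (height c) && (height c p == 0%N))
        (num_fillings m n a p (height c) a.-1)%:R * num_completions m n (height c).
Proof.
move=> pm a0; rewrite num_syt_battery ?addn_gt0 ?a0 ?orbT //.
have := @path_sum m n
  (fun h => if h p == 0%N then (num_fillings m n a p h a.-1)%:R else 0)
  (fun h => (num_fillings m n a p h a)%:R) (num_completions m n).
rewrite num_completions_full mulr1 => ->.
- rewrite [RHS]big_mkcondr; apply: eq_bigr => c _.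
  by case: ifP; rewrite ?mul0r.
- by move=> h h' e; congr (_%:R); apply: eq_num_fillings.
- by move=> h h' e; apply: eq_num_completions.
- move=> h hpart hn hm; rewrite num_fillings_rec // ?a0 ?orbT //= natrD natr_sum.
  by congr (_ + _); case: ifP.
- by move=> h; apply: num_completions_rec.
Qed.

(** The contribution of h to the number of fillings of the battery, divided by
    the number of fillings of the rectangle. One factor of the square comes
    from h and the other from its complement. *)
Definition ideal_weight m n a p (h : nat -> nat) : rat :=
  ((\sum_(j < p) h j + a.-1)`!%:R / (a.-1)`!%:R)
  * ((m * n - \sum_(j < p) h j)`!%:R / (m * n)`!%:R)
  * (\prod_(j < p) ((m - j.+1 + h j)`!%:R / (m - j.+1)`!%:R
                        * ((n + j)`!%:R / (n - h j + j)`!%:R)))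
  * frobenius_cols p h ^+ 2.

Lemma eq_ideal_weight m n a p h h' : (forall i, (i < p)%N -> h i = h' i) ->
  ideal_weight m n a p h = ideal_weight m n a p h'.
Proof.
move=> e; rewrite /ideal_weight (eq_bigr (fun i : 'I_p => h' i)) => [|i _]; last by rewrite e.
congr (_ * _ * _ ^+ 2); first by apply: eq_bigr => j _; rewrite e.
by apply: eq_frobenius => i ip; rewrite e //; lia.
Qed.

Lemma battery_ratio m n a p : (p < m)%N -> (0 < n)%N -> (0 < a)%N ->
  (num_syt (battery_shape m n a p.+1))%:R
    = (num_syt (rect_shape m n))%:R *
      \sum_(c : {ffun 'I_m -> 'I_n.+1} | is_part m (height c) && (height c p == 0%N))
        ideal_weight m n a p (height c).
Proof.
move=> pm n0 a0; rewrite num_syt_battery_sum // big_distrr /=.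
apply: eq_bigr => c /andP[cpart /eqP cp].
have cn i : (height c i <= n)%N by apply: height_le.
rewrite num_fillings_low ?leq_pred // (num_completions_low (p := p)) // 1?ltnW //.
rewrite num_syt_rect // 1?(leq_ltn_trans _ pm) // /ideal_weight expr2.
ring.
Qed.

(** * Four columns and rising factorials *)

Lemma sum_le_ord (n t : nat) (F : nat -> rat) : (t <= n)%N ->
  \sum_(0 <= v < t.+1) F v = \sum_(v < n.+1 | (v <= t)%N) F v.
Proof.
by move=> tn; rewrite big_mkord (big_ord_widen n.+1).
Qed.

Lemma sum_four_columns m n (F : (nat -> nat) -> rat) : (4 < m)%N ->
    (forall h h', (forall i, (i < 4)%N -> h i = h' i) -> F h = F h') ->
  \sum_(c : {ffun 'I_m -> 'I_n.+1} | is_part m (height c) && (height c 4 == 0%N))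
      F (height c)
    = \sum_(0 <= t < n.+1) \sum_(0 <= v < t.+1) \sum_(0 <= w < v.+1)
        \sum_(0 <= r < w.+1) F (nth 0%N [:: t; v; w; r]).
Proof.
move=> m4 FE.
symmetry; rewrite big_mkord.
under eq_bigr => t _.
  have tn : (t <= n)%N by rewrite -ltnS.
  rewrite (sum_le_ord _ tn).
  under eq_bigr => v vt.
    (* every index stays below n, so that all four run over one finite type *)
    have vn := leq_trans vt tn; rewrite (sum_le_ord _ vn).
    under eq_bigr => w wv.
      rewrite (sum_le_ord _ (leq_trans wv vn)).
    over.
    rewrite pair_big_dep.
  over.
  rewrite pair_big_dep.
over.
rewrite pair_big_dep /=; symmetry.
pose cols (q : 'I_n.+1 * ('I_n.+1 * ('I_n.+1 * 'I_n.+1))) : nat -> nat :=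
  nth 0%N [:: q.1 : nat; q.2.1 : nat; q.2.2.1 : nat; q.2.2.2 : nat].
pose quad (c : {ffun 'I_m -> 'I_n.+1}) : 'I_n.+1 * ('I_n.+1 * ('I_n.+1 * 'I_n.+1)) :=
  (inord (height c 0), (inord (height c 1), (inord (height c 2), inord (height c 3)))).
have colsn q i : (cols q i <= n)%N.
  by rewrite /cols; case: i => [|[|[|[|i]]]] /=; rewrite -1?ltnS // nth_nil.
have ofE q i : height (of_height m n (cols q) ) i = cols q i.
  have [im|mi] := ltnP i m; first by rewrite height_of.
  rewrite height_out //; case: i mi => [|[|[|[|i]]]] mi; try lia.
  by rewrite /cols /= nth_nil.
have qE c i : (i < 4)%N -> cols (quad c) i = height c i.
  by case: i => [|[|[|[|i]]]] // _; rewrite /cols /= inordK // ltnS height_le.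
rewrite (reindex_onto (fun q => of_height m n (cols q)) quad) /=; last first.
  move=> c /andP[cpart /eqP c4]; apply: height_inj => i im; rewrite ofE.
  have [i4|i4] := ltnP i 4; first exact: qE.
  rewrite /cols nth_default //; apply/esym/eqP; rewrite -leqn0 -c4.
  by rewrite (is_part_le cpart) // i4 ltnW.
apply: eq_big => [[t [v [w r]]]|[t [v [w r]]] _] /=; last first.
  by apply: FE => i _; rewrite ofE.
have -> : quad (of_height m n (cols (t, (v, (w, r))))) == (t, (v, (w, r))).
  by rewrite /quad !ofE /cols /= !inord_val.
rewrite andbT ofE /= eqxx andbT; apply/is_partP/and3P => [p|[vt wv rw] i im].
  have := p 0%N; have := p 1%N; have := p 2%N; rewrite !ofE /cols /=.
  by move=> -> //; [move=> -> //; [move=> -> //|]|]; lia.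
by rewrite !ofE /cols; case: i im => [|[|[|[|i]]]] //=; rewrite nth_nil.
Qed.

Lemma pochS (F : fieldType) (x : F) s : poch x s.+1 = poch x s * (x + s%:R).
Proof. by rewrite /poch big_ord_recr. Qed.

Lemma pochD (F : fieldType) (x : F) s k : poch x (s + k) = poch x s * poch (x + s%:R) k.
Proof.
elim: k => [|k IH]; first by rewrite addn0 /poch big_ord0 mulr1.
by rewrite addnS !pochS IH -mulrA natrD addrA.
Qed.

Lemma poch_nat k s : poch (k.+1%:R : rat) s = (k + s)`!%:R / k`!%:R.
Proof.
elim: s => [|s IH]; first by rewrite addn0 divff ?fact_neq0 // /poch big_ord0.
rewrite pochS IH addnS factS natrM mulrC mulrA -natrD.
by congr (_%:R * _ / _); lia.
Qed.

Lemma poch1 s : poch (1 : rat) s = s`!%:R.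
Proof. by rewrite (poch_nat 0) add0n divr1. Qed.

Lemma poch_neg k s : (s <= k)%N ->
  poch (- k%:R : rat) s = (-1) ^+ s * (k`!%:R / (k - s)`!%:R).
Proof.
elim: s => [|s IH] sk; first by rewrite subn0 mul1r divff ?fact_neq0 // /poch big_ord0.
rewrite pochS IH ?(ltnW sk) // -(subnSK sk) factS natrM exprS subnSK //.
rewrite natrB ?(ltnW sk) //.
field; rewrite fact_neq0 -natrB ?(ltnW sk) // pnatr_eq0; lia.
Qed.

(** These quotients carry the hook lengths: up to a shift they are the
    differences of the points attached to two columns. *)
Lemma poch_ratio x k s : (s <= x + k)%N ->
  poch (- x%:R - k%:R : rat) s / poch (- x%:R - k.+1%:R) s
    = (x%:R + k.+1%:R - s%:R) / (x%:R + k.+1%:R).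
Proof.
move=> sx; rewrite -!opprD -!natrD addnS !poch_neg //; last exact: ltnW.
rewrite subSn // !factS !natrM -natrB ?subSn //; last exact: ltnW.
by field; rewrite !fact_neq0 signr_eq0 -natrD !nat1r !pnatr_eq0.
Qed.

(** The signs cancel later against those of the rising factorials of -mn. *)
Lemma poch_column m n j s : (j < m)%N -> (s <= n)%N ->
  poch (m%:R - j%:R : rat) s * poch (- n%:R - j%:R) s
    = (-1) ^+ s * ((m - j.+1 + s)`!%:R / (m - j.+1)`!%:R
                   * ((n + j)`!%:R / (n - s + j)`!%:R)).
Proof.
move=> jm sn; rewrite -natrB; last exact: ltnW.
rewrite -(subnSK jm) poch_nat -opprD -natrD poch_neg; last first.
  by rewrite (leq_trans sn) // leq_addr.
have -> : (n - s + j = n + j - s)%N by lia.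
by rewrite mulrCA.
Qed.

Lemma frobenius_cols4 t v w r :
  frobenius_cols 4 (nth 0%N [:: t; v; w; r])
    = (t%:R + 1 - v%:R) * (t%:R + 2 - w%:R) * (t%:R + 3 - r%:R)
      * (v%:R + 1 - w%:R) * (v%:R + 2 - r%:R) * (w%:R + 1 - r%:R)
      / ((t + 3)`!%:R * (v + 2)`!%:R * (w + 1)`!%:R * r`!%:R).
Proof.
rewrite /frobenius_cols /frobenius !vandermonde_recr [vandermonde 0 _]big_ord0.
rewrite !big_ord_recl !big_ord0 /= /bump /=.
rewrite !addn0 !natrD.
set D1 := (X in _ / X); set D2 := (X in _ = _ / X).
have -> : D1 = D2 by rewrite /D1 /D2; ring.
by congr (_ / _); ring.
Qed.

(** The rising factorials of a and of -mn telescope over the four indices, one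
    pair of rising factorials per column gives the remaining factorials, and
    the six quotients between columns give the Vandermonde product. *)
Lemma ideal_weight4 m n a t v w r : (4 < m)%N -> (0 < a)%N ->
    (t <= n)%N -> (v <= t)%N -> (w <= v)%N -> (r <= w)%N ->
  ideal_weight m n a 4 (nth 0%N [:: t; v; w; r])
    = factorA m n a t * factorB m n a t v * factorC m n a t v w
      * factorD m n a t v w r.
Proof.
move=> m4 a0 tn vt wv rw.
have [vn wn rn] : [/\ (v <= n)%N, (w <= n)%N & (r <= n)%N] by split; lia.
have [wt rt rv] : [/\ (w <= t)%N, (r <= t)%N & (r <= v)%N] by split; lia.
have PD (x : rat) : poch x t * poch (x + t%:R) v * poch (x + t%:R + v%:R) w
    * poch (x + t%:R + v%:R + w%:R) r = poch x (t + v + w + r).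
  by rewrite !pochD !natrD !addrA.
have PA : poch a%:R t * poch (a%:R + t%:R) v * poch (a%:R + t%:R + v%:R) w
    * poch (a%:R + t%:R + v%:R + w%:R) r
    = (t + v + w + r + a.-1)`!%:R / (a.-1)`!%:R :> rat.
  by rewrite PD -{1}(prednK a0) poch_nat addnC.
have PM : poch (- (m%:R * n%:R)) t * poch (- (m%:R * n%:R) + t%:R) v
    * poch (- (m%:R * n%:R) + t%:R + v%:R) w
    * poch (- (m%:R * n%:R) + t%:R + v%:R + w%:R) r
    = (-1) ^+ t * (-1) ^+ v * (-1) ^+ w * (-1) ^+ r *
      ((m * n)`!%:R / (m * n - (t + v + w + r))`!%:R) :> rat.
  have le : (t + v + w + r <= m * n)%N.
    by apply: (@leq_trans (4 * n)); [lia|rewrite leq_mul2r ltnW ?orbT].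
  by rewrite PD -natrM poch_neg // !exprD.
have C0 : poch m%:R t * poch (- n%:R) t = _ :=
  etrans (f_equal2 (fun x y => poch x t * poch y t) (esym (subr0 _)) (esym (subr0 _)))
    (@poch_column m n 0 t (leq_ltn_trans (leq0n _) m4) tn).
have C1 : poch (m%:R - 1) v * poch (- n%:R - 1) v = _ :=
  @poch_column m n 1 v (leq_ltn_trans (isT : 1 <= 4)%N m4) vn.
have C2 := @poch_column m n 2 w (leq_ltn_trans (isT : 2 <= 4)%N m4) wn.
have C3 := @poch_column m n 3 r (leq_ltn_trans (isT : 3 <= 4)%N m4) rn.
have B x s : (s <= x)%N -> poch (- x%:R) s / poch (- x%:R - 1) s
    = (x%:R + 1 - s%:R) / (x%:R + 1) :> rat.
  by move=> sx; rewrite -(@poch_ratio x 0) ?addn0 // subr0.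
have B1 := B _ _ vt; have Cw2 := B _ _ wv; have D3 := B _ _ rw.
have Cw1 : poch (- t%:R - 1) w / poch (- t%:R - 2) w = _ :=
  @poch_ratio t 1 w (leq_trans wt (leq_addr _ _)).
have D2 : poch (- v%:R - 1) r / poch (- v%:R - 2) r = _ :=
  @poch_ratio v 1 r (leq_trans rv (leq_addr _ _)).
have D1 := @poch_ratio t 2 r (leq_trans rt (leq_addr _ _)).
rewrite /ideal_weight !big_ord_recl !big_ord0 frobenius_cols4 /= /bump /= !addn0 !add1n.
have -> : (t + (v + (w + r)) = t + v + w + r)%N by rewrite !addnA.
rewrite /factorA /factorB /factorC /factorD !poch1.
transitivity ((poch a%:R t * poch (a%:R + t%:R) v * poch (a%:R + t%:R + v%:R) w
    * poch (a%:R + t%:R + v%:R + w%:R) r) /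
  (poch (- (m%:R * n%:R)) t * poch (- (m%:R * n%:R) + t%:R) v
    * poch (- (m%:R * n%:R) + t%:R + v%:R) w
    * poch (- (m%:R * n%:R) + t%:R + v%:R + w%:R) r) *
  ((poch m%:R t * poch (- n%:R) t) * (poch (m%:R - 1) v * poch (- n%:R - 1) v)
   * (poch (m%:R - 2) w * poch (- n%:R - 2) w)
   * (poch (m%:R - 3) r * poch (- n%:R - 3) r))
  * ((poch (- t%:R) v / poch (- t%:R - 1) v)
     * (poch (- t%:R - 1) w / poch (- t%:R - 2) w)
     * (poch (- v%:R) w / poch (- v%:R - 1) w)
     * (poch (- t%:R - 2) r / poch (- t%:R - 3) r)
     * (poch (- v%:R - 1) r / poch (- v%:R - 2) r)
     * (poch (- w%:R) r / poch (- w%:R - 1) r)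
     / (t`!%:R * v`!%:R * w`!%:R * r`!%:R)) ^+ 2 : rat).
  rewrite PA PM C0 C1 C2 C3 B1 Cw1 Cw2 D1 D2 D3.
  rewrite !addn0.
  have -> : (t%:R + 1 - v%:R) / (t%:R + 1) * ((t%:R + 2 - w%:R) / (t%:R + 2))
    * ((v%:R + 1 - w%:R) / (v%:R + 1)) * ((t%:R + 3 - r%:R) / (t%:R + 3))
    * ((v%:R + 2 - r%:R) / (v%:R + 2)) * ((w%:R + 1 - r%:R) / (w%:R + 1))
    / (t`!%:R * v`!%:R * w`!%:R * r`!%:R)
    = (t%:R + 1 - v%:R) * (t%:R + 2 - w%:R) * (t%:R + 3 - r%:R)
      * (v%:R + 1 - w%:R) * (v%:R + 2 - r%:R) * (w%:R + 1 - r%:R)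
      / ((t + 3)`!%:R * (v + 2)`!%:R * (w + 1)`!%:R * r`!%:R) :> rat.
    clear; rewrite !addnS !addn0 !factS !natrM.
    by field; rewrite !fact_neq0 -?natrD ?nat1r ?natr1 !pnatr_eq0.
  set H := _ / ((t + 3)`!%:R * _ * _ * _).
  by field; rewrite !fact_neq0 !signr_eq0.
clear.
rewrite !invfM.
ring.
Qed.

Lemma battery5_rowsE m n a :
  multi_hyp n (battery5_rows m n a)
    = \sum_(0 <= t < n.+1) \sum_(0 <= v < t.+1) \sum_(0 <= w < v.+1)
        \sum_(0 <= r < w.+1)
          factorA m n a t * factorB m n a t v * factorC m n a t v w
          * factorD m n a t v w r.
Proof.
have term (u l : seq rat) s :
    hyp_term u l 1 s = (\prod_(x <- u) poch x s) / (\prod_(y <- l) poch y s * s`!%:R).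
  by rewrite /hyp_term expr1n div1r invfM mulrA.
rewrite /battery5_rows /=; apply: eq_bigr => t _; rewrite big_distrr /=.
apply: eq_bigr => v _; rewrite !big_distrr /=.
apply: eq_bigr => w _; rewrite !big_distrr /=.
apply: eq_bigr => r _; rewrite mulr1 !term -[RHS]mulrA -[RHS]mulrA.
congr (_ * (_ * (_ * _))); rewrite !big_cons !big_nil.
- by congr (_ / _); ring.
- by congr (_ / _); ring.
- by congr (_ / _); ring.
- by congr (_ / _); ring.
Qed.

Theorem theorem5p9 (m n a : nat) (hm : (5 <= m)%N) (hn : (0 < n)%N)
    (ha : (0 < a)%N) :
  (num_syt (battery_shape m n a 5))%:R
    = (num_syt (rect_shape m n))%:R * multi_hyp n (battery5_rows m n a) :> rat
  /\
  (num_syt (battery_shape m n a 5))%:R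
    = (num_syt (rect_shape m n))%:R
      * \sum_(0 <= t < n.+1) \sum_(0 <= v < t.+1) \sum_(0 <= w < v.+1)
          \sum_(0 <= r < w.+1)
            factorA m n a t * factorB m n a t v * factorC m n a t v w
            * factorD m n a t v w r :> rat.
Proof.
suff E : \sum_(c : {ffun 'I_m -> 'I_n.+1} | is_part m (height c) && (height c 4 == 0%N))
      ideal_weight m n a 4 (height c) = multi_hyp n (battery5_rows m n a).
  by rewrite -battery5_rowsE (battery_ratio hm hn ha) E.
rewrite battery5_rowsE sum_four_columns //; last by move=> h h'; apply: eq_ideal_weight.
apply: eq_big_nat => t /andP[_ tn]; apply: eq_big_nat => v /andP[_ vt].
apply: eq_big_nat => w /andP[_ wv]; apply: eq_big_nat => r /andP[_ rw].
by rewrite ideal_weight4.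
Qed.
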